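(* Let $D$ be an integral domain and let $\mathcal{E}(D)=\{P\in\operatorname{Spec}(D)\mid D_P\text{ is a valuation domain}\}$. Then the following are equivalent. (i) $D$ is a P$v$MD. (ii) $D$ is essential and the set $\{D_P\mid P\in\mathcal{E}(D)\}$ of all essential valuation overrings of $D$ has the GV-finite character property. (iii) $D$ is essential and, for all $a,b\in D\setminus\{0\}$, $aD\cap bD=F^{v}$ for some nonzero finitely generated fractional ideal $F$ of $D$ (in particular, $F\subseteq aD\cap bD$).
   Context: Let $D$ be an integral domain with quotient field $K$. An overring of $D$ is a ring between $D$ and $K$. For a nonzero $D$-submodule $E$ of $K$, $(D:E)=\{x\in K\mid xE\subseteq D\}$ and $E^v=(D:(D:E))$ (with $(D:0)=K$); $E^t=\bigcup\{F^v\mid F\subseteq E,\ F \text{ nonzero finitely generated}\}$. $D$ is a P$v$MD (Prüfer $v$-multiplication domain) if $(II^{-1})^t=D$ for every nonzero finitely generated ideal $I$ of $D$, where $I^{-1}=(D:I)$. An essential valuation overring of $D$ is a valuation overring of the form $D_P$ with $P\in\operatorname{Spec}(D)$. $D$ is essential if $D$ is an intersection of some family of essential valuation overrings of $D$. A family $\{S_\lambda\mid\lambda\in\Lambda\}$ of overrings of $D$ with $D=\bigcap_\lambda S_\lambda$ (a defining family of $D$) has the GV-finite character property if, for each ideal $I$ of $D$ such that $IS_\lambda=S_\lambda$ for every $\lambda\in\Lambda$, there exists a finitely generated ideal $J\subseteq I$ of $D$ such that $JS_\lambda=S_\lambda$ for every $\lambda\in\Lambda$. *)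

(* Defs.v *)
From HB Require Import structures.
From mathcomp Require Import all_boot all_order all_algebra.
From mathcomp Require Import boolp classical_sets.

Set Implicit Arguments.
Unset Strict Implicit.
Unset Printing Implicit Defensive.

Import GRing.Theory.
Local Open Scope classical_set_scope.
Local Open Scope ring_scope.

(* For an integral domain D, the quotient field is K = {fraction D}, and D is
   identified with its image in K.  Submodules, ideals, fractional ideals and
   overrings of D are all subsets of K; only the prime ideals, used to index
   the localizations, are predicates on D itself. *)

Notation "x %:F" := (FracField.tofrac x) : ring_scope.

Section Domain.
Variable D : idomainType.
Local Notation K := {fraction D}.

Definition domK : set K := range (fun a : D => a%:F).

Definition submodule (E : set K) : Prop :=
  [/\ E 0,
      forall x y, E x -> E y -> E (x + y)
    & forall (a : D) x, E x -> E (a%:F * x)].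

Definition ideal (I : set K) : Prop := submodule I /\ I `<=` domK.

Definition fractional_ideal (F : set K) : Prop :=
  submodule F /\ exists2 d : D, d != 0 & forall x, F x -> domK (d%:F * x).

Definition span (s : seq K) : set K :=
  [set x | exists c : 'I_(size s) -> D, x = \sum_(i < size s) (c i)%:F * s`_i].

Definition fin_gen (F : set K) : Prop := exists s : seq K, F = span s.

(* The set of finite sums of products; for an ideal I and an overring S,
   [mul_set I S] is the extension IS. *)
Definition mul_set (E F : set K) : set K :=
  [set x | exists (n : nat) (e f : 'I_n -> K),
     [/\ forall i, E (e i), forall i, F (f i) & x = \sum_(i < n) e i * f i]].

(* (D : E), which is also E^-1 *)
Definition colon (E : set K) : set K :=
  [set x | forall y, E y -> domK (x * y)].

Definition vclosure (E : set K) : set K := colon (colon E).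

Definition tclosure (E : set K) : set K :=
  \bigcup_(F in [set F | [/\ fin_gen F, F <> [set 0] & F `<=` E]]) vclosure F.

Definition PvMD : Prop :=
  forall I : set K, ideal I -> fin_gen I -> I <> [set 0] ->
    tclosure (mul_set I (colon I)) = domK.

Definition overring (S : set K) : Prop :=
  GRing.subring_closed (mem S) /\ domK `<=` S.

(* K is also the quotient field of any overring V, so this says that the
   overring V is a valuation domain. *)
Definition valuation_overring (V : set K) : Prop :=
  overring V /\ forall x : K, x != 0 -> V x \/ V x^-1.

Definition Spec : set {pred D} :=
  [set P | idealr_closed P /\ prime_idealr_closed P].

Definition localization (P : {pred D}) : set K :=
  [set x | exists a s : D, s \notin P /\ x = a%:F / s%:F].

Definition essential_primes : set {pred D} :=
  [set P | Spec P /\ valuation_overring (localization P)].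

Definition essential_valuation_overring (V : set K) : Prop :=
  valuation_overring V /\ exists2 P, Spec P & V = localization P.

(* The intersection of an empty family is K. *)
Definition defining_family (L : Type) (A : set L) (S : L -> set K) : Prop :=
  (forall l, A l -> overring (S l)) /\ domK = \bigcap_(l in A) S l.

Definition essential : Prop :=
  exists (L : Type) (A : set L) (S : L -> set K),
    defining_family A S /\ forall l, A l -> essential_valuation_overring (S l).

Definition GV_finite_character (L : Type) (A : set L) (S : L -> set K) : Prop :=
  defining_family A S /\
  forall I : set K, ideal I -> (forall l, A l -> mul_set I (S l) = S l) ->
    exists J : set K,
      [/\ ideal J, fin_gen J, J `<=` I
        & forall l, A l -> mul_set J (S l) = S l].

Definition principal (a : D) : set K := [set a%:F * x | x in domK].

End Domain.

Arguments domK : clear implicits.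
Arguments PvMD : clear implicits.
Arguments Spec : clear implicits.
Arguments essential_primes : clear implicits.
Arguments essential : clear implicits.

(* Main.v *)
(* Call a finite list s of elements of D, not all zero, GV if (D : s) = D, and
   call D comparable if any a, b in D admit a GV list each of whose members x
   satisfies a | xb or b | xa. Each of the three conditions is
   equivalent to comparability.
   Products of GV lists are GV, so an induction extends comparability from two
   elements to a finitely generated I, and I I^-1 then contains a GV list: D is a
   PvMD.
   By Zorn, an ideal without GV lists lies in a maximal such ideal P, which is
   prime; comparability makes D_P a valuation domain, whereas no essential prime
   contains a GV list. This gives essentiality (for the ideals (D : x)) and the
   GV-finite character property.
   Conversely, each of the conditions yields a GV list inside the ideal
   (aD : b) + (bD : a): from I I^-1 with I = (a, b), from the finite character, or,
   if aD and bD meet in F^v, from the elements f/a and f/b for generators f of F.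
   If instead comparability is given, the elements xb or xa generate such an F. *)
Require Import Defs.
From mathcomp Require Import all_boot all_order all_algebra.
From mathcomp Require Import boolp classical_sets.
Import Defs GRing.Theory.
Local Open Scope classical_set_scope.
Local Open Scope ring_scope.

(** * Divisibility, GV lists and comparability *)

Definition divides (D : idomainType) (a b : D) : Prop := exists d, b = d * a.

(** Since s lies in D, the second clause amounts to (D : s) = D. When D is a field it holds of every
    list, and the first clause then excludes lists of zeros. *)
Definition gv (D : idomainType) (s : seq D) : Prop :=
  (exists2 x, x \in s & x != 0) /\
  forall y : {fraction D},
    (forall x, x \in s -> domK D (y * x%:F)) -> domK D y.

Definition gv_comparable (D : idomainType) (a b : D) : Prop :=
  exists2 s : seq D, gv D s &
    forall x, x \in s -> divides D a (x * b) \/ divides D b (x * a).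

(** Ideals as subsets of D itself instead of K, the form to which Zorn's lemma is applied. *)
Definition set_ideal (D : idomainType) (I : set D) : Prop :=
  [/\ I 0, forall x y, I x -> I y -> I (x + y) & forall a x, I x -> I (a * x)].

(** * Fractions and the image of D in K *)

Lemma fraction_repr (D : idomainType) (x : {fraction D}) :
  exists a b : D, b != 0 /\ x = a%:F / b%:F.
Proof.
elim/quotW: x => r; exists \n_r, \d_r; split; first exact: denom_ratioP.
have d0 : (\d_r)%:F != 0 :> {fraction D} by rewrite tofrac_eq0 denom_ratioP.
apply: (mulIf d0); rewrite divfK //; unlock FracField.tofrac.
rewrite -[LHS]FracField.pi_mul; apply/eqmodP => /=.
by rewrite FracField.equivfE /FracField.mulf /= !numden_Ratio ?mulr1 ?oner_eq0
  ?denom_ratioP // mulrC.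
Qed.

Lemma domK1 (D : idomainType) : domK D 1.
Proof. by exists 1 => //; rewrite tofrac1. Qed.

Lemma domK_tofrac (D : idomainType) (a : D) : domK D a%:F.
Proof. by exists a. Qed.

Lemma domKD (D : idomainType) (x y : {fraction D}) :
  domK D x -> domK D y -> domK D (x + y).
Proof. by move=> [a _ <-] [b _ <-]; exists (a + b) => //; rewrite tofracD. Qed.

Lemma domKM (D : idomainType) (x y : {fraction D}) :
  domK D x -> domK D y -> domK D (x * y).
Proof. by move=> [a _ <-] [b _ <-]; exists (a * b) => //; rewrite tofracM. Qed.

Lemma domK_sum (D : idomainType) (n : nat) (f : 'I_n -> {fraction D}) :
  (forall i, domK D (f i)) -> domK D (\sum_(i < n) f i).
Proof.
move=> fD; apply: (big_ind (domK D)) => //; last exact: domKD.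
by exists 0 => //; rewrite tofrac0.
Qed.

Lemma domK_div (D : idomainType) (a b : D) :
  a != 0 -> domK D (b%:F / a%:F) <-> divides D a b.
Proof.
move=> a0; have a0F : a%:F != 0 :> {fraction D} by rewrite tofrac_eq0.
split=> [[d _ E]|[d ->]]; exists d => //; last by rewrite tofracM mulfK.
by apply/eqP; rewrite -tofrac_eq tofracM E divfK.
Qed.

Lemma domK_seq (D : idomainType) (s : seq {fraction D}) :
  (forall x, x \in s -> domK D x) -> exists t : seq D, s = [seq a%:F | a <- t].
Proof.
elim: s => [|x s IHs] sD; first by exists [::].
have [a _ <-] := sD x (mem_head _ _).
have [|t ->] := IHs; last by exists (a :: t).
by move=> y ys; apply: sD; rewrite inE ys orbT.
Qed.

(** * Submodules, spans and products *)

Lemma submodule_sum (D : idomainType) (E : set {fraction D}) (n : nat)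
    (f : 'I_n -> {fraction D}) :
  submodule E -> (forall i, E (f i)) -> E (\sum_(i < n) f i).
Proof. by move=> [E0 ED _] fE; apply: (big_ind E). Qed.

Lemma submodule_span (D : idomainType) (s : seq {fraction D}) :
  submodule (span s).
Proof.
split=> [|x y [c ->] [d ->]|a x [c ->]].
- by exists (fun=> 0); rewrite big1 // => i _; rewrite tofrac0 mul0r.
- exists (fun i => c i + d i); rewrite -big_split.
  by apply: eq_bigr => i _; rewrite tofracD mulrDl.
- exists (fun i => a * c i); rewrite mulr_sumr.
  by apply: eq_bigr => i _; rewrite tofracM mulrA.
Qed.

Lemma mem_span (D : idomainType) (s : seq {fraction D}) x : x \in s -> span s x.
Proof.
move=> xs; have ltxs : (index x s < size s)%N by rewrite index_mem.
exists (fun i => (i == Ordinal ltxs)%:R); rewrite (bigD1 (Ordinal ltxs)) //=.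
rewrite eqxx tofrac1 mul1r nth_index // big1 ?addr0 // => i /negbTE ->.
by rewrite tofrac0 mul0r.
Qed.

Lemma span_sub (D : idomainType) (s : seq {fraction D}) (E : set {fraction D}) :
  submodule E -> (forall x, x \in s -> E x) -> span s `<=` E.
Proof.
move=> Emod sE x [c ->]; apply: submodule_sum => // i.
by have [_ _] := Emod; apply; apply: sE; rewrite mem_nth.
Qed.

(** With [span_sub], it reduces membership of y in (D : E) to generators of E; the trace of this
    submodule on D is the ideal of denominators of y. *)
Lemma submodule_preim_mul (D : idomainType) (y : {fraction D}) :
  submodule [set x | domK D (y * x)].
Proof.
split=> [|x z Dx Dz|a x Dx] /=.
- by exists 0; rewrite // mulr0 tofrac0.
- by rewrite mulrDr; apply: domKD.
- by rewrite mulrCA; apply: domKM => //; apply: domK_tofrac.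
Qed.

Lemma colon_span (D : idomainType) (s : seq {fraction D}) (y : {fraction D}) :
  colon (span s) y <-> forall x, x \in s -> domK D (y * x).
Proof.
split=> [ys x xs|ys]; first by apply: ys; apply: mem_span.
exact: span_sub (submodule_preim_mul D y) ys.
Qed.

Lemma submodule_mul_set (D : idomainType) (E F : set {fraction D}) :
  submodule E -> submodule (mul_set E F).
Proof.
move=> [_ _ EM]; split=> [|x y|a x].
- by exists 0%N, (fun=> 0), (fun=> 0); split=> [[]|[]|]; rewrite // big_ord0.
- move=> [n [e [f [eE fF ->]]]] [m [e' [f' [eE' fF' ->]]]].
  exists (n + m)%N, (fun i => match split i with inl j => e j | inr j => e' j end),
    (fun i => match split i with inl j => f j | inr j => f' j end).
  split=> [i|i|]; first by case: splitP.
    by case: splitP.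
  rewrite big_split_ord; congr (_ + _); apply: eq_bigr => i _.
    by rewrite (unsplitK (inl i)).
  by rewrite (unsplitK (inr i)).
- move=> [n [e [f [eE fF ->]]]]; exists n, (fun i => a%:F * e i), f; split=> // [i|]; first exact: EM.
  by rewrite mulr_sumr; apply: eq_bigr => i _; rewrite mulrA.
Qed.

Lemma mul_set_mem (D : idomainType) (E F : set {fraction D}) x y :
  E x -> F y -> mul_set E F (x * y).
Proof.
move=> Ex Fy; exists 1%N, (fun=> x), (fun=> y); split=> //.
by rewrite big_ord1.
Qed.

Lemma set_ideal_preim (D : idomainType) (I : set {fraction D}) :
  submodule I -> set_ideal D [set a | I a%:F].
Proof.
move=> [I0 ID IM]; split=> [|x y Ix Iy|a x Ix] /=.
- by rewrite tofrac0.
- by rewrite tofracD; apply: ID.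
- by rewrite tofracM; apply: IM.
Qed.

Lemma ideal_span_map (D : idomainType) (s : seq D) :
  ideal (span [seq a%:F : {fraction D} | a <- s]).
Proof.
split; first exact: submodule_span.
apply: span_sub => [|x /mapP[a _ ->]]; last exact: domK_tofrac.
have -> : domK D = [set x | domK D (1 * x)].
  by apply/seteqP; split=> x /=; rewrite mul1r.
exact: submodule_preim_mul.
Qed.

(** * Products and minima for GV lists and their local analogues *)

(* Lists of elements of D that can play the role of the unit ideal: the GV lists,
   and, for a prime P, the lists not contained in P. *)
Definition unit_like (D : idomainType) (G : seq D -> Prop) : Prop :=
  G [:: 1] /\
  forall (s : seq D) (f : D -> seq D), G s -> (forall x, x \in s -> G (f x)) ->
    G [seq x * y | x <- s, y <- f x].

(** If y * x * z lies in D for all x in s and z in f x, then y * x lies in (D : f x) = D for each x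
    in s, hence y in (D : s) = D. *)
Lemma unit_like_gv (D : idomainType) : unit_like D (gv D).
Proof.
split=> [|s f [[x xs x0] sD] fgv].
  split; first by exists 1; rewrite ?mem_head ?oner_eq0.
  by move=> y /(_ 1 (mem_head _ _)); rewrite tofrac1 mulr1.
split=> [|y yD].
  have [[z zf z0] _] := fgv x xs; exists (x * z); last by rewrite mulf_neq0.
  by apply/allpairsPdep; exists x, z.
apply: sD => z zs; have [_] := fgv z zs; apply=> w wf.
by rewrite -mulrA -tofracM; apply: yD; apply/allpairsPdep; exists z, w.
Qed.

(* A common multiple of two multipliers, one comparing the minimal element of
   the tail with its other members, one comparing it with the new head. *)
Lemma unit_like_minimum (D : idomainType) (G : seq D -> Prop) (l : seq D) :
  unit_like D G ->
  (forall a b, exists2 s, G s &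
     forall x, x \in s -> divides D a (x * b) \/ divides D b (x * a)) ->
  l != [::] ->
  exists2 s, G s & forall x, x \in s ->
    exists2 a, a \in l & forall b, b \in l -> divides D a (x * b).
Proof.
move=> [G1 GM] Gcmp; elim: l => // a [|a' l] IHl _.
  exists [:: 1] => // x _; exists a; rewrite ?mem_head // => b.
  by rewrite inE => /eqP ->; exists x.
have [//|s Gs sP] := IHl.
(* The minimum c of the tail depends on the multiplier x, so the list comparing c with the head a
   does too; hence the dependent products in [unit_like]. *)
have /choice[f fP] : forall x, exists t, x \in s -> G t /\
    forall y, y \in t -> exists2 c, c \in a :: a' :: l &
      forall b, b \in a :: a' :: l -> divides D c (x * y * b).
  move=> x; have [xs|] := boolP (x \in s); last by exists [::].
  have [c cl cP] := sP x xs; have [t Gt tP] := Gcmp a c.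
  (* If a divides y * c, the head a becomes the minimum; otherwise c remains it. *)
  exists t => _; split=> // y /tP[[d yE]|[d yE]].
    exists a; rewrite ?mem_head // => b; rewrite inE => /predU1P[->|].
      by exists (x * y).
    move=> /cP[e bE]; exists (e * d).
    by rewrite mulrAC bE -[LHS]mulrA (mulrC c) yE mulrA.
  exists c; first by rewrite inE cl orbT.
  move=> b; rewrite inE => /predU1P[->|/cP[e bE]].
    by exists (x * d); rewrite -mulrA yE mulrA.
  by exists (e * y); rewrite mulrAC bE mulrAC.
exists [seq x * y | x <- s, y <- f x].
  by apply: GM => // x xs; have [] := fP x xs.
by move=> z /allpairsPdep[x [y [xs yf ->]]]; have [_] := fP x xs; apply.
Qed.

(** * Prime ideals and localizations *)

Lemma spec_ideal (D : idomainType) (P : {pred D}) :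
  Spec D P ->
  [/\ 0 \in P, 1 \notin P, forall x y, x \in P -> y \in P -> x + y \in P,
    forall a x, x \in P -> a * x \in P
    & forall x y, x \notin P -> y \notin P -> x * y \notin P].
Proof.
move=> [[P0 P1 PM] Pprime]; split=> // [x y Px Py|a x Px|x y /negP Px /negP Py].
- by rewrite -[x]mul1r; apply: PM.
- by rewrite -[_ * _]addr0; apply: PM.
- by apply/negP => /Pprime/orP[].
Qed.

Lemma notin_prime_neq0 (D : idomainType) (P : {pred D}) (t : D) :
  Spec D P -> t \notin P -> t%:F != 0 :> {fraction D}.
Proof.
move=> /spec_ideal[P0 _ _ _ _]; rewrite tofrac_eq0.
by apply: contraNneq => ->.
Qed.

Lemma overring_localization (D : idomainType) (P : {pred D}) :
  Spec D P -> overring (localization P).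
Proof.
move=> SP; have [P0 P1 PD PI PM] := spec_ideal D P SP; split; first split.
- by apply/mem_set; exists 1, 1; rewrite divff ?tofrac_eq0 ?oner_eq0 // tofrac1.
- move=> x y /set_mem[a [s [sP ->]]] /set_mem[b [t [tP ->]]]; apply/mem_set.
  exists (a * t - b * s), (s * t); split; first exact: PM.
  have s0 := notin_prime_neq0 D P s SP sP; have t0 := notin_prime_neq0 D P t SP tP.
  rewrite tofracB !tofracM mulrBl -mulf_div divff // mulr1 (mulrC s%:F).
  by rewrite -mulf_div divff // mulr1.
- move=> x y /set_mem[a [s [sP ->]]] /set_mem[b [t [tP ->]]]; apply/mem_set.
  by exists (a * b), (s * t); rewrite !tofracM mulf_div; split; first exact: PM.
- by move=> _ [a _ <-]; exists a, 1; rewrite tofrac1 divr1.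
Qed.

Lemma localization_mul (D : idomainType) (P : {pred D}) x y :
  Spec D P -> localization P x -> localization P y -> localization P (x * y).
Proof.
move=> /overring_localization[[_ _ VM] _] Vx Vy; apply/set_mem.
by apply: VM; apply/mem_set.
Qed.

Lemma localization_sum (D : idomainType) (P : {pred D}) (n : nat)
    (f : 'I_n -> {fraction D}) :
  Spec D P -> (forall i, localization P (f i)) -> localization P (\sum_(i < n) f i).
Proof.
move=> /overring_localization[[V1 VB VM] DV] fV.
have V0 : localization P 0 by apply: DV; exists 0; rewrite ?tofrac0.
apply: (big_ind (localization P)) => // x y Vx Vy.
(* [subring_closed] provides subtraction, so x + y is written x - (0 - y). *)
rewrite -[y]opprK -[- y]sub0r; apply/set_mem.
by apply: (VB); [|apply: (VB)]; apply/mem_set.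
Qed.

Lemma localization_denom (D : idomainType) (P : {pred D}) (t : D) (y : {fraction D}) :
  Spec D P -> t \notin P -> domK D (y * t%:F) -> localization P y.
Proof.
move=> SP tP [a _ E]; exists a, t; split=> //.
by rewrite E mulfK // (notin_prime_neq0 D P).
Qed.

(** The right side is comparability with lists not contained in P instead of GV lists, so that
    [unit_like_minimum] applies at P. A denominator outside P of a/b or b/a is a multiplier
    comparing a and b, and conversely. *)
Lemma valuation_localizationP (D : idomainType) (P : {pred D}) :
  Spec D P ->
  valuation_overring (localization P) <->
  forall a b : D, exists2 s : seq D, (exists2 t, t \in s & t \notin P) &
    forall x, x \in s -> divides D a (x * b) \/ divides D b (x * a).
Proof.
move=> SP; have [P0 P1 PD PI PM] := spec_ideal D P SP; split=> [[_ PV] a b|cmp].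
  suff [t tP tab] : exists2 t, t \notin P & divides D a (t * b) \/ divides D b (t * a).
    exists [:: t]; first by exists t; rewrite ?mem_head.
    by move=> x; rewrite inE => /eqP ->.
  have [->|a0] := eqVneq a 0.
    by exists 1 => //; right; exists 0; rewrite mulr0 mul0r.
  have [->|b0] := eqVneq b 0.
    by exists 1 => //; left; exists 0; rewrite mulr0 mul0r.
  have a0F : a%:F != 0 :> {fraction D} by rewrite tofrac_eq0.
  have b0F : b%:F != 0 :> {fraction D} by rewrite tofrac_eq0.
  have [|[c [t [tP E]]]|[c [t [tP E]]]] := PV (a%:F / b%:F).
  - by rewrite mulf_neq0 ?invr_eq0.
  - exists t => //; right; exists c; apply/eqP.
    have t0 := notin_prime_neq0 D P t SP tP.
    rewrite -tofrac_eq !tofracM; apply/eqP; move/eqP: E.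
    by rewrite eqr_div // mulrC => /eqP.
  - exists t => //; left; exists c; apply/eqP.
    have t0 := notin_prime_neq0 D P t SP tP.
    rewrite -tofrac_eq !tofracM; apply/eqP; move/eqP: E.
    by rewrite invf_div eqr_div // mulrC => /eqP.
split; first exact: overring_localization.
move=> x; have [a [b [b0 ->]]] := fraction_repr D x => ab0.
have b0F : b%:F != 0 :> {fraction D} by rewrite tofrac_eq0.
have a0F : a%:F != 0 :> {fraction D}.
  by apply: contraNneq ab0 => ->; rewrite mul0r.
have [s [t ts tP] /(_ t ts)[[d E]|[d E]]] := cmp a b.
  right; apply: (localization_denom D P t) => //; exists d => //.
  by rewrite invf_div mulrAC -tofracM (mulrC b) E tofracM mulfK.
left; apply: (localization_denom D P t) => //; exists d => //.
by rewrite mulrAC -tofracM (mulrC a) E tofracM mulfK.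
Qed.

Lemma unit_like_prime (D : idomainType) (P : {pred D}) :
  Spec D P -> unit_like D (fun s : seq D => exists2 t, t \in s & t \notin P).
Proof.
move=> /spec_ideal[P0 P1 PD PI PM]; split=> [|s f [x xs xP] /(_ x xs)[y yf yP]].
  by exists 1; rewrite ?mem_head.
by exists (x * y); [apply/allpairsPdep; exists x, y|apply: PM].
Qed.

(* Locally at P the list is generated by one of its members a, so some t outside P
   has t/a in (D : s) = D; thus a divides t. *)
Lemma gv_notin_prime (D : idomainType) (P : {pred D}) (s : seq D) :
  essential_primes D P -> gv D s -> exists2 x, x \in s & x \notin P.
Proof.
move=> [SP /(valuation_localizationP D P SP) cmp] [[x xs x0] sD].
have [|l [t tl tP] /(_ t tl)[a sa aP]] :=
    unit_like_minimum D _ s (unit_like_prime D P SP) cmp.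
  by case: (s) xs.
have [P0 P1 PD PI PM] := spec_ideal D P SP.
(* If a = 0, then t * x = 0 for the nonzero member x of s, so t = 0 would lie in P. *)
have a0 : a != 0.
  apply: contraTneq tP => a0; have [d /eqP] := aP x xs.
  rewrite a0 mulr0 mulf_eq0 (negbTE x0) orbF negbK => /eqP ->; exact: P0.
have /domK_div-/(_ a0)[d tE] : domK D (t%:F / a%:F).
  apply: sD => y ys; have [d E] := aP y ys; exists d => //.
  by rewrite mulrAC -tofracM E tofracM mulfK // tofrac_eq0.
by exists a => //; apply: contra tP; rewrite tE; apply: PI.
Qed.

(** * The ideal of comparing multipliers *)

(** This is (aD : b) + (bD : a) inside K. A sum u + v need not compare a and b, but u and v each
    do. *)
Definition comparing (D : idomainType) (a b : D) : set {fraction D} :=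
  [set x | exists u v,
    [/\ x = (u + v)%:F, divides D a (u * b) & divides D b (v * a)]].

Lemma ideal_comparing (D : idomainType) (a b : D) : ideal (comparing D a b).
Proof.
split; last by move=> _ [u [v [-> _ _]]]; apply: domK_tofrac.
split=> [|x y|e x].
- by exists 0, 0; rewrite addr0 tofrac0; split=> //; exists 0; rewrite !mul0r.
- move=> [u [v [-> [c uE] [d vE]]]] [u' [v' [-> [c' uE'] [d' vE']]]].
  exists (u + u'), (v + v'); rewrite -tofracD addrACA; split=> //.
    by exists (c + c'); rewrite mulrDl uE uE' mulrDl.
  by exists (d + d'); rewrite mulrDl vE vE' mulrDl.
- move=> [u [v [-> [c uE] [d vE]]]]; exists (e * u), (e * v); rewrite -tofracM mulrDr; split=> //.
    by exists (e * c); rewrite -mulrA uE mulrA.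
  by exists (e * d); rewrite -mulrA vE mulrA.
Qed.

(** Each member of s is split as u + v. If y * u and y * v always lie in D, so does y times each
    member of s, and y is in D. *)
Lemma gv_comparable_of_fractions (D : idomainType) (a b : D)
    (s : seq {fraction D}) :
  a != 0 ->
  (forall x, x \in s -> comparing D a b x) ->
  (forall y, (forall x, x \in s -> domK D (y * x)) -> domK D y) ->
  gv_comparable D a b.
Proof.
move=> a0 sab sD.
have /choice[f fP] : forall x, exists w : D * D, x \in s ->
    [/\ x = (w.1 + w.2)%:F, divides D a (w.1 * b) & divides D b (w.2 * a)].
  move=> x; have [/sab[u [v uvP]]|] := boolP (x \in s); first by exists (u, v).
  by exists (0, 0).
(* The head a supplies a nonzero member; it compares because a divides a * b. *)
exists (a :: [seq (f x).1 | x <- s] ++ [seq (f x).2 | x <- s]).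
  split=> [|y yD]; first by exists a; rewrite ?mem_head.
  apply: sD => x xs; have [-> _ _] := fP x xs; rewrite tofracD mulrDr.
  apply: domKD; apply: yD; rewrite inE mem_cat.
    by rewrite (map_f (fun z => (f z).1)) ?orbT.
  by rewrite (map_f (fun z => (f z).2)) ?orbT.
move=> x; rewrite inE mem_cat => /or3P[/eqP ->|/mapP[z zs ->]|/mapP[z zs ->]].
- by left; exists b; rewrite mulrC.
- by left; have [] := fP z zs.
- by right; have [] := fP z zs.
Qed.

Lemma gv_comparable_all (D : idomainType) :
  (forall a b : D, a != 0 -> b != 0 -> gv_comparable D a b) ->
  forall a b : D, gv_comparable D a b.
Proof.
move=> cmp a b; have [G1 _] := unit_like_gv D.
have [->|a0] := eqVneq a 0.
  by exists [:: 1] => // x _; right; exists 0; rewrite mulr0 mul0r.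
have [->|b0] := eqVneq b 0; last exact: cmp.
by exists [:: 1] => // x _; left; exists 0; rewrite mulr0 mul0r.
Qed.

(** * Ideals without GV lists *)

(* An ideal maximal among those containing I and no GV list is a prime P with
   D_P a valuation domain. *)
Lemma gv_sub_ideal (D : idomainType) (I : set D) :
  (forall a b : D, gv_comparable D a b) -> set_ideal D I ->
  (forall P, essential_primes D P -> exists2 x, I x & x \notin P) ->
  exists2 s, gv D s & forall x, x \in s -> I x.
Proof.
move=> cmp Iid IE; apply: contrapT => noI.
have [G1 GM] := unit_like_gv D.
(* [Zorn_bigcup] includes the empty chain, whose union is empty; joining I to X makes that case
   valid too. *)
pose good (X : set D) := set_ideal D (X `|` I) /\
  forall s, gv D s -> ~ forall x, x \in s -> (X `|` I) x.
have good0 : good set0.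
  by rewrite /good set0U; split=> // s gvs sI; apply: noI; exists s.
have [F Fgood Ftot|A [[Mid Mgv] Amax]] := @Zorn_bigcup D good.
  set U := \bigcup_(X in F) X.
  (* A finite list in U or I already lies in a single X or I, so both halves of [good] pass to the
     union of the chain. *)
  have finU (s : seq D) : (forall x, x \in s -> (U `|` I) x) ->
      exists X, [/\ X = set0 \/ F X, good X, X `<=` U
        & forall x, x \in s -> (X `|` I) x].
    elim: s => [|x s IHs] sU; first by exists set0; split=> //; left.
    have [|X [FX gX XU sX]] := IHs.
      by move=> y ys; apply: sU; rewrite inE ys orbT.
    have [[Y FY Yx]|Ix] := sU x (mem_head _ _); last first.
      by exists X; split=> // y; rewrite inE => /predU1P[->|/sX //]; right.
    have YU : Y `<=` U by apply: bigcup_sup.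
    have [XY|YX] : X `<=` Y \/ Y `<=` X.
      by case: FX => [->|FX]; [left; apply: sub0set|apply: Ftot].
    - exists Y; split=> //; [by right|exact: Fgood|].
      move=> y; rewrite inE => /predU1P[->|/sX[/XY|]]; by [left|left|right].
    - exists X; split=> // y; rewrite inE => /predU1P[->|/sX //].
      by left; apply: YX.
  split; last first.
    by move=> s gvs /finU[X [_ [_ Xgv] _ sX]]; apply: Xgv sX.
  have [I0 _ _] := Iid; split=> [|x y Ux Uy|a x Ux]; first by right.
    have [|X [_ [[_ XD _] _] XU sX]] := finU [:: x; y].
      by move=> z; rewrite !inE => /orP[]/eqP ->.
    by apply: (setSU XU); apply: XD; apply: sX; rewrite !inE eqxx ?orbT.
  have [|X [_ [[_ _ XM] _] XU sX]] := finU [:: x].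
    by move=> z; rewrite !inE => /eqP ->.
  by apply: (setSU XU); apply: XM; apply: sX; rewrite !inE eqxx.
set M := A `|` I in Mid Mgv; have [M0 MD MM] := Mid.
(* By maximality of M, the larger ideal M + aD contains a GV list. *)
have grow a : ~ M a -> exists2 s, gv D s &
    forall x, x \in s -> exists m d, M m /\ x = m + d * a.
  move=> Ma; apply: contrapT => noN.
  pose N := [set x | exists m d, M m /\ x = m + d * a].
  have MN : M `<=` N by move=> m Mm; exists m, 0; rewrite mul0r addr0.
  have NI : N `|` I = N.
    by rewrite setUidl // => x Ix; apply: MN; right.
  apply: (Amax N).
    split; first by move=> x Ax; apply: MN; left.
    move=> NA; apply: Ma; left; apply: NA; exists 0, 1.
    by rewrite add0r mul1r.
  rewrite /good NI; split=> [|s gvs sN]; last by apply: noN; exists s.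
  split; first exact: MN.
    move=> _ _ [m [d [Mm ->]]] [m' [d' [Mm' ->]]]; exists (m + m'), (d + d').
    by rewrite mulrDl addrACA; split; first exact: MD.
  move=> c _ [m [d [Mm ->]]]; exists (c * m), (c * d).
  by rewrite mulrDr mulrA; split; first exact: MM.
pose P : {pred D} := fun x => `[<M x>].
have PE x : (x \in P) = `[<M x>] by [].
have SP : Spec D P.
  split; first split; rewrite ?PE.
  - exact/asboolP.
  - apply/asboolP => M1; apply: (Mgv [:: 1]) => // x.
    by rewrite inE => /eqP ->.
  - move=> a x y /asboolP Mx /asboolP My; apply/asboolP.
    by apply: MD => //; apply: MM.
  move=> a b; rewrite !PE => /asboolP Mab.
  apply: contrapT => /negP; rewrite negb_or => /andP[/asboolP Ma /asboolP Mb].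
  have [s gvs sP] := grow a Ma; have [t gvt tP] := grow b Mb.
  (* (M + aD)(M + bD) lies in M + abD, which is inside M when a * b is in M. *)
  apply: (Mgv [seq x * y | x <- s, y <- t]); first exact: GM.
  move=> z /allpairsPdep[x [y [/sP[m [d [Mm ->]]] /tP[m' [d' [Mm' ->]]] ->]]].
  rewrite mulrDr [in X in _ + X]mulrDl; apply: (MD); first exact: MM.
  by apply: MD; [rewrite mulrC|rewrite mulrACA]; apply: MM.
have EP : essential_primes D P.
  split=> //; apply/(valuation_localizationP D P SP) => a b.
  (* The comparing list is GV, so it is not contained in M. *)
  have [s gvs sP] := cmp a b; exists s => //.
  apply: contrapT => nosP; apply: (Mgv s) => // x xs; apply: contrapT => Mx.
  by apply: nosP; exists x => //; rewrite PE; apply/asboolP.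
have [x Ix] := IE P EP; rewrite PE => /asboolP; apply.
by right.
Qed.

(** * Extensions of ideals to localizations *)

Lemma span_map_neq0 (D : idomainType) (s : seq D) (x : D) :
  x \in s -> x != 0 -> span [seq a%:F : {fraction D} | a <- s] <> [set 0].
Proof.
move=> xs /negP x0 E; have : span [seq a%:F : {fraction D} | a <- s] x%:F.
  by apply: mem_span; apply: map_f.
by rewrite E => /eqP; rewrite tofrac_eq0.
Qed.

Lemma mul_localization (D : idomainType) (P : {pred D}) (I : set {fraction D}) (t : D) :
  Spec D P -> ideal I -> I t%:F -> t \notin P ->
  mul_set I (localization P) = localization P.
Proof.
move=> SP [_ ID] It tP; have [_ DP] := overring_localization D P SP.
apply/seteqP; split=> [_ [n [e [f [eI fP ->]]]]|x Px].
  apply: localization_sum => // i; apply: localization_mul => //.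
  by apply: DP; apply: ID.
have t0 := notin_prime_neq0 D P t SP tP.
rewrite -(divfK t0 x) mulrC; apply: mul_set_mem => //.
apply: localization_mul => //; exists 1, t.
by rewrite tofrac1 mul1r.
Qed.

(** If I were inside P, its extension would lie in the maximal ideal P D_P, the set [Q] of the
    proof. But 1 = a/s with a in P puts s in P. *)
Lemma notin_prime_of_mul_localization (D : idomainType) (P : {pred D})
    (I : set {fraction D}) :
  Spec D P -> ideal I -> mul_set I (localization P) = localization P ->
  exists2 t, I t%:F & t \notin P.
Proof.
move=> SP [_ ID] IP; have [P0 P1 PD PI PM] := spec_ideal D P SP.
apply: contrapT => noI.
have [[V1 _ _] _] := overring_localization D P SP.
have : mul_set I (localization P) 1 by rewrite IP; apply/set_mem.
pose Q := [set x | exists a s : D, [/\ a \in P, s \notin P & x = a%:F / s%:F]].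
move=> [n [e [f [eI fP E]]]].
have [a [s [aP sP /eqP]]] : Q 1.
  rewrite E; apply: (big_ind Q) => [|x y [a [s [aP sP ->]]] [b [t [bP tP ->]]]|i _].
  - by exists 0, 1; rewrite tofrac0 mul0r.
  - exists (a * t + b * s), (s * t).
    have s0 := notin_prime_neq0 D P s SP sP.
    have t0 := notin_prime_neq0 D P t SP tP.
    split; [|exact: PM|by rewrite addf_div // tofracD !tofracM].
    by apply: PD; [rewrite mulrC|rewrite mulrC]; apply: PI.
  - have [c _ ec] := ID _ (eI i); have [d [s [sP ->]]] := fP i.
    exists (d * c), s; split=> //; last by rewrite -ec tofracM mulrA (mulrC c%:F).
    apply: PI; apply: contrapT => cP; apply: noI; exists c; last exact/negP.
    by rewrite ec.
rewrite eq_sym -(inj_eq (mulIf (notin_prime_neq0 D P s SP sP))).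
rewrite divfK ?(notin_prime_neq0 D P) // mul1r tofrac_eq => /eqP as_.
by rewrite -as_ aP in sP.
Qed.

(** * Comparability and the PvMD property *)

(** For I = aD + bD and f in I^-1, the elements u = f * a and v = f * b of D satisfy u * b = v * a,
    so I I^-1 lies in [comparing a b]. As 1 is in the t-closure of I I^-1, some finite l in I I^-1
    has (D : l) inside D. *)
Lemma gv_comparable_of_PvMD (D : idomainType) (a b : D) :
  PvMD D -> a != 0 -> gv_comparable D a b.
Proof.
move=> DP a0; set s := [seq x%:F : {fraction D} | x <- [:: a; b]].
have /DP := ideal_span_map D [:: a; b]; rewrite -/s => IP.
have : tclosure (mul_set (span s) (colon (span s))) 1.
  rewrite IP; [exact: domK1|by exists s|].
  by apply: (span_map_neq0 D _ a); rewrite ?mem_head.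
move=> [_ [[l ->] _ lI] lv]; have [Tmod _] := ideal_comparing D a b.
apply: (gv_comparable_of_fractions D a b l a0) => [x xl|y yl]; last first.
  by rewrite -[y]mul1r; apply: lv; apply/colon_span.
have [n [e [f [eI fI ->]]]] := lI x (mem_span D l x xl).
apply: submodule_sum => // i; have /colon_span fs := fI i.
have [u _ uE] : domK D (f i * a%:F) by apply: fs; rewrite mem_head.
have [v _ vE] : domK D (f i * b%:F) by apply: fs; rewrite !inE eqxx orbT.
have uv : u * b = v * a.
  by apply/eqP; rewrite -tofrac_eq !tofracM uE vE mulrAC.
have [c ->] := eI i; rewrite /= big_ord_recl big_ord1 /= mulrDl -!mulrA.
have [_ TD TM] := Tmod; apply: TD; apply: TM; rewrite mulrC.
  exists u, 0; rewrite addr0 uE; split=> //; first by exists v.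
  by exists 0; rewrite !mul0r.
exists 0, v; rewrite add0r vE; split=> //; last by exists u.
by exists 0; rewrite !mul0r.
Qed.

(** For each x in the GV list given by [unit_like_minimum], some generator a of I divides x * c for
    all generators c. Then x/a is in I^-1 if x is nonzero, and x = a * (x/a) is in I I^-1. *)
Lemma PvMD_of_gv_comparable (D : idomainType) :
  (forall a b : D, gv_comparable D a b) -> PvMD D.
Proof.
move=> cmp I [Imod ID] [l lE] I0.
have [|t tE] := domK_seq D l.
  by move=> x xl; apply: ID; rewrite lE; apply: mem_span.
have [b bt b0] : exists2 b, b \in t & b != 0.
  apply: contrapT => not; apply: I0; apply/seteqP; split=> [|_ ->]; last first.
    by have [] := Imod.
  rewrite lE; apply: span_sub => [|x]; first split=> //=.
  - by move=> x y -> ->; rewrite addr0.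
  - by move=> a x ->; rewrite mulr0.
  rewrite tE => /mapP[a at_ ->] /=; apply/eqP; rewrite tofrac_eq0.
  by apply: contrapT => /negP a0; apply: not; exists a.
have It a : a \in t -> I a%:F.
  by move=> at_; rewrite lE tE; apply: mem_span; apply: map_f.
have [|s [_ sD] sP] := unit_like_minimum D _ t (unit_like_gv D) cmp.
  by case: (t) bt.
(* F inside I I^-1, hence inside D, puts 1 in (D : F), so z = z * 1 is in D. *)
apply/seteqP; split=> [z [F [_ _ FI] /(_ 1)]|z Dz].
  rewrite mulr1; apply=> y /FI[n [e [f [eI fI ->]]]]; rewrite mul1r.
  by apply: domK_sum => i; rewrite mulrC; apply: fI.
(* The nonzero generator b witnesses that the span is nonzero; it is in I I^-1 because 1 is in
   I^-1. *)
exists (span [seq a%:F | a <- b :: s]); last first.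
  move=> y /colon_span yD; apply: domKM => //; apply: sD => x xs.
  by apply: yD; apply: map_f; rewrite inE xs orbT.
split; [by eexists|by apply: (span_map_neq0 D _ b); rewrite ?mem_head|].
have Mmod := submodule_mul_set D I (colon I) Imod.
apply: span_sub => // _ /mapP[x + ->]; rewrite inE => /predU1P[->|xs].
  rewrite -[b%:F]mulr1; apply: mul_set_mem; first exact: It.
  by move=> y /ID; rewrite mul1r.
have [->|x0] := eqVneq x 0; first by rewrite tofrac0; have [] := Mmod.
have [a at_ aP] := sP x xs.
have a0 : a%:F != 0 :> {fraction D}.
  rewrite tofrac_eq0; apply: contraTneq x0 => a0; have [d /eqP] := aP b bt.
  by rewrite a0 mulr0 mulf_eq0 (negbTE b0) orbF negbK.
rewrite -(divfK a0 x%:F) mulrC; apply: mul_set_mem; first exact: It.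
rewrite lE; apply/colon_span => y; rewrite tE => /mapP[c ct ->].
by have [d E] := aP c ct; exists d => //; rewrite mulrAC -tofracM E tofracM mulfK.
Qed.

(** * Essentiality and the GV-finite character property *)

Lemma essential_GV_of_gv_comparable (D : idomainType) :
  (forall a b : D, gv_comparable D a b) ->
  essential D /\ GV_finite_character (essential_primes D) (@localization D).
Proof.
move=> cmp.
have Dfam : defining_family (essential_primes D) (@localization D).
  split=> [P [_ [] //]|]; apply/seteqP; split=> [x Dx P [SP _]|x xP].
    by have [_] := overring_localization D P SP; apply.
  (* If x lies in every D_P, its denominators form an ideal contained in no essential prime. A GV
     list s in that ideal has x * s inside D, so x is in D. *)
  have [|P EP|s [_ sD] sx] := gv_sub_ideal D [set d : D | domK D (x * d%:F)] cmp.
  - exact: set_ideal_preim (submodule_preim_mul D x).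
  - have [a [t [tP E]]] := xP P EP; exists t => //=; exists a => //.
    by rewrite E divfK // (notin_prime_neq0 D P) //; case: EP.
  - exact: sD.
split.
  exists {pred D}, (essential_primes D), (@localization D); split=> // P [SP VP].
  by split=> //; exists P.
split=> // I idI IP.
have [|P EP|s gvs sI] := gv_sub_ideal D [set a : D | I a%:F] cmp.
- by apply: set_ideal_preim; case: idI.
- apply: notin_prime_of_mul_localization (IP P EP) => //.
  by case: EP.
exists (span [seq a%:F | a <- s]); split.
- exact: ideal_span_map.
- by eexists.
- by apply: span_sub => [|_ /mapP[x /sI Ix ->]] //; case: idI.
move=> P EP; have [x xs xP] := gv_notin_prime D P s EP gvs.
apply: (mul_localization D P _ x) => //; first by case: EP.
  exact: ideal_span_map.
by apply: mem_span; apply: map_f.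
Qed.

(** At each essential prime P the valuation property gives a comparing multiplier outside P, so
    [comparing a b] extends to D_P. Finite character then yields a finitely generated J inside
    it. *)
Lemma gv_comparable_of_GV_finite_character (D : idomainType) (a b : D) :
  GV_finite_character (essential_primes D) (@localization D) ->
  a != 0 -> gv_comparable D a b.
Proof.
move=> [[_ DE] fc] a0; have idT := ideal_comparing D a b.
have [P EP|J [_ [s JE] JT JP]] := fc (comparing D a b) idT.
  have [SP /(valuation_localizationP D P SP) cmp] := EP.
  have [l [t tl tP] /(_ t tl) tab] := cmp a b.
  apply: (mul_localization D P _ t) => //.
  case: tab => tab; [exists t, 0; rewrite addr0|exists 0, t; rewrite add0r].
    by split=> //; exists 0; rewrite !mul0r.
  by split=> //; exists 0; rewrite !mul0r.
apply: (gv_comparable_of_fractions D a b s a0) => [x xs|y ys].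
  by apply: JT; rewrite JE; apply: mem_span.
rewrite DE => P EP; have [SP _] := EP.
have [[V1 _ _] DP] := overring_localization D P SP.
(* Since 1 is in J D_P, y = y * 1 is in (yJ) D_P, hence in D_P as yJ lies in D. *)
have : mul_set J (localization P) 1 by rewrite (JP P EP); apply/set_mem.
move=> [n [e [f [eJ fP E]]]]; rewrite -[y]mulr1 E mulr_sumr.
apply: localization_sum => // i; rewrite mulrA; apply: localization_mul => //.
by apply: DP; move/colon_span: ys; rewrite -JE; apply.
Qed.

(** * Intersections of two principal ideals *)

Lemma principalP (D : idomainType) (a : D) (x : {fraction D}) :
  a != 0 -> principal a x <-> domK D (x / a%:F).
Proof.
move=> a0; have a0F : a%:F != 0 :> {fraction D} by rewrite tofrac_eq0.
split=> [[y Dy <-]|Dx]; first by rewrite mulrC mulKf.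
by exists (x / a%:F) => //; rewrite mulrC divfK.
Qed.

(** F is generated by a * b and, for each y in s, a common multiple of a and b of the form y * a or
    y * b. If z is in (D : F) and x in both aD and bD, then x * z * y = (x/a) * (z * y * a), or the
    same with b, is in D, so x * z is in D. Conversely, 1/a and 1/b lie in (D : F). *)
Lemma cap_principal_vclosure (D : idomainType) (a b : D) :
  gv_comparable D a b -> a != 0 -> b != 0 ->
  exists F : set {fraction D},
    [/\ fractional_ideal F, fin_gen F, F <> [set 0]
      & principal a `&` principal b = vclosure F].
Proof.
move=> [s [_ sD] sab] a0 b0.
have a0F : a%:F != 0 :> {fraction D} by rewrite tofrac_eq0.
have b0F : b%:F != 0 :> {fraction D} by rewrite tofrac_eq0.
have /choice[f fP] : forall x, exists m, x \in s ->
    (m = x * a \/ m = x * b) /\ (divides D a m /\ divides D b m).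
  move=> x; have [/sab[xab|xab]|] := boolP (x \in s); last by exists 0.
    by exists (x * b) => _; split; [right|split=> //; exists x].
  by exists (x * a) => _; split; [left|split=> //; exists x].
(* The head a * b is a common multiple that keeps F nonzero. *)
set t := a * b :: [seq f x | x <- s].
have tab m : m \in t -> divides D a m /\ divides D b m.
  rewrite inE => /predU1P[->|/mapP[x /fP[_ xab] ->] //].
  by split; [exists b; rewrite mulrC|exists a].
exists (span [seq m%:F | m <- t]).
have [Fmod FD] := ideal_span_map D t.
split; [split=> //|by eexists| |].
- by exists 1; rewrite ?oner_eq0 // => x /FD; rewrite tofrac1 mul1r.
- by apply: (span_map_neq0 D _ (a * b)); rewrite ?mem_head ?mulf_neq0.
apply/seteqP; split=> [x [/principalP-/(_ a0) xa /principalP-/(_ b0) xb] z|x xv].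
  move=> /colon_span zF; apply: sD => y ys.
  have zy : domK D (z * (f y)%:F).
    by apply: zF; apply: map_f; rewrite inE map_f ?orbT.
  have [[E|E] _] := fP y ys; rewrite E tofracM in zy.
    have -> : x * z * y%:F = (x / a%:F) * (z * (y%:F * a%:F)).
      rewrite -[in LHS](divfK a0F x) -!mulrA; do 2!congr (_ * _).
      by rewrite mulrC -mulrA.
    exact: domKM.
  have -> : x * z * y%:F = (x / b%:F) * (z * (y%:F * b%:F)).
    rewrite -[in LHS](divfK b0F x) -!mulrA; do 2!congr (_ * _).
    by rewrite mulrC -mulrA.
  exact: domKM.
split.
  apply/(principalP D a x a0); apply: xv; apply/colon_span => _ /mapP[m mt ->].
  by rewrite mulrC; apply/domK_div => //; case: (tab m mt).
apply/(principalP D b x b0); apply: xv; apply/colon_span => _ /mapP[m mt ->].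
by rewrite mulrC; apply/domK_div => //; case: (tab m mt).
Qed.

(** For a generator x of F, x/a is in (bD : a) and x/b in (aD : b). Let y multiply all of these into
    D. Given D_P in the essential family, some t outside P has t * b or t * a in F^v; say t * b. As
    y/b is in (D : F), t * y = (t * b) * (y/b) is in D, so y is in D_P. *)
Lemma gv_comparable_of_cap_principal (D : idomainType) (a b : D)
    (F : set {fraction D}) :
  essential D -> a != 0 -> b != 0 -> fin_gen F ->
  principal a `&` principal b = vclosure F -> gv_comparable D a b.
Proof.
move=> [L [A [S [[_ DE] SE]]]] a0 b0 [f FE] abE.
have a0F : a%:F != 0 :> {fraction D} by rewrite tofrac_eq0.
have b0F : b%:F != 0 :> {fraction D} by rewrite tofrac_eq0.
have fab x : x \in f -> domK D (x / a%:F) /\ domK D (x / b%:F).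
  move=> xf; have : vclosure F x.
    by rewrite FE => y /colon_span/(_ x xf); rewrite mulrC.
  by rewrite -abE => -[/(principalP D a x a0) ? /(principalP D b x b0)].
apply: (gv_comparable_of_fractions D a b
    ([seq x / a%:F | x <- f] ++ [seq x / b%:F | x <- f]) a0).
  move=> z; rewrite mem_cat => /orP[]/mapP[x /fab[[g _ gE] [h _ hE]] ->].
    exists 0, g; rewrite add0r gE; split=> //.
      by exists 0; rewrite !mul0r.
    by exists h; apply/eqP; rewrite -tofrac_eq !tofracM gE hE !divfK.
  exists h, 0; rewrite addr0 hE; split=> //.
    by exists g; apply/eqP; rewrite -tofrac_eq !tofracM gE hE !divfK.
  by exists 0; rewrite !mul0r.
move=> y yD; rewrite DE => l Al; have [VS [P SP SlE]] := SE l Al.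
rewrite SlE in VS *.
have /(valuation_localizationP D P SP)/(_ a b)[s [t ts tP] tab] := VS.
apply: (localization_denom D P t) => //.
have [[d tE]|[d tE]] := tab t ts.
  have : vclosure F (t * b)%:F.
    rewrite -abE; split; last first.
      by apply/principalP => //; rewrite tofracM mulfK //; exists t.
    by apply/principalP => //; rewrite tE tofracM mulfK //; exists d.
  have yb : colon F (y / b%:F).
    rewrite FE; apply/colon_span => x xf; rewrite mulrAC -mulrA; apply: yD.
    by rewrite mem_cat (map_f (fun x => x / b%:F)) ?orbT.
  by move=> /(_ _ yb); rewrite tofracM mulrCA mulfK // => ?.
have : vclosure F (t * a)%:F.
  rewrite -abE; split.
    by apply/principalP => //; rewrite tofracM mulfK //; exists t.
  by apply/principalP => //; rewrite tE tofracM mulfK //; exists d.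
have ya : colon F (y / a%:F).
  rewrite FE; apply/colon_span => x xf; rewrite mulrAC -mulrA; apply: yD.
  by rewrite mem_cat (map_f (fun x => x / a%:F)).
by move=> /(_ _ ya); rewrite tofracM mulrCA mulfK.
Qed.

Theorem theorem5p5 (D : idomainType) :
  [<-> PvMD D;
       essential D /\
         GV_finite_character (essential_primes D) (@localization D);
       essential D /\
         forall a b : D, a != 0 -> b != 0 ->
           exists F : set {fraction D},
             [/\ fractional_ideal F, fin_gen F, F <> [set 0]
               & principal a `&` principal b = vclosure F]].
Proof.
tfae.
- move=> DP; apply: essential_GV_of_gv_comparable; apply: gv_comparable_all.
  by move=> a b a0 _; apply: gv_comparable_of_PvMD.
- move=> [Dess Dfc]; split=> // a b a0 b0; apply: cap_principal_vclosure => //.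
  exact: gv_comparable_of_GV_finite_character.
- move=> [Dess Dcap]; apply: PvMD_of_gv_comparable; apply: gv_comparable_all.
  move=> a b a0 b0; have [F [_ Ffg _ FE]] := Dcap a b a0 b0.
  exact: gv_comparable_of_cap_principal FE.
Qed.
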